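(* Consider the plant $\dot x=Ax+Bu+Ew$ with regulated output $z=Dx$ and measured output $y=Hx+Fw$, where $x\in\mathbb R^n$, $u\in\mathbb R^r$, $z\in\mathbb R^d$, $y\in\mathbb R^l$, $w\in\mathbb R^p$ is an unmeasurable constant disturbance ($\dot w=0$, unknown initial value), $z_r\in\mathbb R^d$ is a constant reference signal ($\dot z_r=0$, known initial value), all matrices are constant, and $\operatorname{rank}B=r$, $\operatorname{rank}D=d$. Necessary and sufficient conditions for the existence of a PI-regulator $\dot q=z-z_r$, $u=K_1\hat x+K_2q$ (with $\hat x$ an estimate of $x$, as described in the context) which ensures that $z\to z_r$ as $t\to\infty$ for all constant unmeasurable disturbances $w$ and for all constant reference signals $z_r$ are the following: a. the pair $(A,B)$ is stabilizable; b. the pair $(A,H)$ is detectable; c. $r\ge d$ and $l\ge p$; d. the system zeros of the systems $\dot x=Ax+Ew,\ y=Hx+Fw$ (input $w$, output $y$) and $\dot x=Ax+Bu,\ z=Dx$ (input $u$, output $z$) are not equal to zero.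
   Context: In the PI-regulator $\dot q=z-z_r$, $u=K_1\hat x+K_2q$, $q\in\mathbb R^d$ is the regulator state, $K_1$ ($r\times n$) and $K_2$ ($r\times d$) are constant matrices, and $\hat x\in\mathbb R^n$ is the estimate of $x$ obtained (together with an estimate $\hat w$ of $w$) from the full-order state observer $$\frac{d}{dt}\begin{bmatrix} \hat x \\ \hat w \end{bmatrix}=\begin{bmatrix} A & E \\ O & O \end{bmatrix}\begin{bmatrix} \hat x \\ \hat w \end{bmatrix}+\begin{bmatrix} B \\ O \end{bmatrix}u+L\left(y-[H,F]\begin{bmatrix} \hat x \\ \hat w \end{bmatrix}\right),$$ where $L$ is a constant $(n+p)\times l$ matrix. In the tracking problem being solved, $z(t)\to z_r$ is required for arbitrary initial conditions. A complex number $s_0$ is a system zero of a system $\dot x=Ax+B'v,\ y'=C'x+D'v$ with $n$ states, $m$ inputs and $k$ outputs if $\operatorname{rank}\begin{bmatrix} s_0I_n-A & -B' \\ C' & D' \end{bmatrix}<n+\min(m,k)$. The pair $(A,B)$ is stabilizable if $A+BK$ has all eigenvalues in $\operatorname{Re}s<0$ for some real matrix $K$; $(A,H)$ is detectable if $(A^T,H^T)$ is stabilizable.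
   Formalization: The PI-regulator is additionally required to make the closed loop (plant, observer, regulator) asymptotically stable when w=0 and z_r=0, and the observer estimates to converge; without stability, condition a and part of d are not necessary. *)

(* Defs.v *)
From HB Require Import structures.
From mathcomp Require Import all_boot all_order all_algebra.
From mathcomp Require Import all_classical all_reals all_analysis.
From mathcomp Require Import complex.

Set Implicit Arguments.
Unset Strict Implicit.
Unset Printing Implicit Defensive.

Import Order.TTheory GRing.Theory Num.Theory.
Import numFieldNormedType.Exports.

Local Open Scope classical_set_scope.
Local Open Scope ring_scope.

Definition Cmx (R : realType) (m n : nat) (M : 'M[R]_(m, n)) : 'M[R[i]]_(m, n) :=
  map_mx (real_complex R) M.

Definition hurwitz (R : realType) (n : nat) (M : 'M[R]_n) : Prop :=
  forall s : R[i], eigenvalue (Cmx M) s -> complex.Re s < 0.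

Definition stabilizable (R : realType) (n r : nat)
    (A : 'M[R]_n) (B : 'M[R]_(n, r)) : Prop :=
  exists K : 'M[R]_(r, n), hurwitz (A + B *m K).

Definition detectable (R : realType) (n l : nat)
    (A : 'M[R]_n) (H : 'M[R]_(l, n)) : Prop :=
  stabilizable A^T H^T.

(* System zeros of  x' = A x + B v,  y = C x + D v. *)
Definition system_zero (R : realType) (n m k : nat)
    (A : 'M[R]_n) (B : 'M[R]_(n, m)) (C : 'M[R]_(k, n)) (D : 'M[R]_(k, m))
    (s0 : R[i]) : Prop :=
  (\rank (block_mx (s0%:M - Cmx A) (- Cmx B) (Cmx C) (Cmx D)) < n + minn m k)%N.

(* Trajectories, on the time interval [0, +oo[, of the plant with constant
   disturbance w in closed loop with the observer and the regulator with
   constant reference zr.  The initial values x 0, q 0, xh 0, wh 0 are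
   unconstrained, so that a property of all trajectories is a property for
   arbitrary initial conditions. *)
Definition closed_loop (R : realType) (n r d l p : nat)
    (A : 'M[R]_n) (B : 'M[R]_(n, r)) (E : 'M[R]_(n, p))
    (D : 'M[R]_(d, n)) (H : 'M[R]_(l, n)) (F : 'M[R]_(l, p))
    (K1 : 'M[R]_(r, n)) (K2 : 'M[R]_(r, d)) (L : 'M[R]_(n + p, l))
    (w : 'cV[R]_p) (zr : 'cV[R]_d)
    (x : R -> 'cV[R]_n) (q : R -> 'cV[R]_d)
    (xh : R -> 'cV[R]_n) (wh : R -> 'cV[R]_p) : Prop :=
  forall t : R, 0 <= t ->
    let u := K1 *m xh t + K2 *m q t in
    let y := H *m x t + F *m w in
    let z := D *m x t in
    [/\ is_derive t (1 : R) x (A *m x t + B *m u + E *m w),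
        is_derive t (1 : R) q (z - zr) &
        is_derive t (1 : R) (fun s => col_mx (xh s) (wh s))
          (block_mx A E 0 0 *m col_mx (xh t) (wh t) + col_mx B 0 *m u
           + L *m (y - row_mx H F *m col_mx (xh t) (wh t)))].

(* The three requirements on a PI-regulator (K1, K2) with observer gain L:
   - the closed-loop system is asymptotically stable, i.e. without exogenous
     signals (w = 0, zr = 0) every trajectory tends to 0 (for a linear
     time-invariant system this attractivity implies Lyapunov stability);
   - (xh, wh) is an estimate of (x, w);
   - z = D x tends to zr for all w and zr.
   Stability does not follow from the other two: for A = diag(0, 1),
   B = D^T = (1, 0)^T, H = 1 and p = 0, they hold with K1 = (-2, 0), K2 = -1
   and L = A + 1, although (A, B) is not stabilizable. *)
Definition PI_regulator (R : realType) (n r d l p : nat)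
    (A : 'M[R]_n) (B : 'M[R]_(n, r)) (E : 'M[R]_(n, p))
    (D : 'M[R]_(d, n)) (H : 'M[R]_(l, n)) (F : 'M[R]_(l, p))
    (K1 : 'M[R]_(r, n)) (K2 : 'M[R]_(r, d)) (L : 'M[R]_(n + p, l)) : Prop :=
  [/\ forall x q xh wh,
        closed_loop A B E D H F K1 K2 L 0 0 x q xh wh ->
        [/\ x t @[t --> +oo] --> (0 : 'cV[R]_n),
            q t @[t --> +oo] --> (0 : 'cV[R]_d),
            xh t @[t --> +oo] --> (0 : 'cV[R]_n) &
            wh t @[t --> +oo] --> (0 : 'cV[R]_p)],
      forall w zr x q xh wh,
        closed_loop A B E D H F K1 K2 L w zr x q xh wh ->
        xh t - x t @[t --> +oo] --> (0 : 'cV[R]_n) /\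
        wh t @[t --> +oo] --> w &
      forall w zr x q xh wh,
        closed_loop A B E D H F K1 K2 L w zr x q xh wh ->
        D *m x t @[t --> +oo] --> zr].

(* Main.v *)
Require Import Defs.
From HB Require Import structures.
From mathcomp Require Import all_boot all_order all_algebra.
From mathcomp Require Import all_classical all_reals all_analysis.
From mathcomp Require Import complex.
From mathcomp Require Import ring lra.

Set Implicit Arguments.
Unset Strict Implicit.
Unset Printing Implicit Defensive.

Import Order.TTheory GRing.Theory Num.Theory.
Import numFieldNormedType.Exports.
Local Open Scope ring_scope.

(** In the coordinates (x - x*, q - q*, xh - x, wh - w), where (x*, q* ) is the
    equilibrium belonging to (w, zr), the closed loop is an autonomous linear
    system with block triangular matrix; its diagonal blocks are the plant with
    regulator [[A + B K1, B K2], [D, 0]] and the observer [[A, E], [0, 0]] -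
    L [H, F].  Hence a PI-regulator is the same thing as a choice of K1, K2, L
    making both blocks Hurwitz: the first asks for stabilizability of
    ([[A, 0], [D, 0]], [[B], [0]]), the second, after transposition, for
    stabilizability of ([[A^T, 0], [E^T, 0]], [[H^T], [F^T]]).  By the Hautus
    test the modes s <> 0 of such an integral extension are those of the
    original pair, and at s = 0 the test says that [[A, B], [D, 0]] (respectively
    [[A, E], [H, F]] transposed) has full row rank, that is d <= r (p <= l) and 0
    is not a system zero.

    The Hautus test itself is proved over the complex numbers by induction on
    the dimension, splitting off one eigenvalue at a time and moving it by a
    rank-one feedback, and then transferred to a real feedback through the
    Lyapunov inequality, whose solutions can be replaced by their real parts.
    The same inequality gives the quadratic Lyapunov function showing that all
    trajectories of a Hurwitz system tend to 0. *)

(** * Dissipative matrices and the Hautus condition *)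

Section Dissipative.
Local Open Scope sesquilinear_scope.
Variable C : numClosedFieldType.

(** * Hermitian form on complex row vectors *)

Definition dot n (u v : 'rV[C]_n) : C := (u *m v ^t*) 0 0.

Lemma dotE n (u v : 'rV[C]_n) : dot u v = \sum_j u 0 j * (v 0 j)^*.
Proof. by rewrite /dot mxE; apply: eq_bigr => j _; rewrite !mxE. Qed.

Lemma dotxx n (u : 'rV[C]_n) : dot u u = \sum_j `|u 0 j| ^+ 2.
Proof. by rewrite dotE; apply: eq_bigr => j _; rewrite normCK. Qed.

Lemma dotxx_ge0 n (u : 'rV[C]_n) : 0 <= dot u u.
Proof. by rewrite dotxx sumr_ge0 // => j _; rewrite exprn_ge0. Qed.

Lemma dotxx_eq0 n (u : 'rV[C]_n) : (dot u u == 0) = (u == 0).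
Proof.
rewrite dotxx psumr_eq0; last by move=> j _; rewrite exprn_ge0.
apply/allP/eqP => [u0|-> j _]; last by rewrite mxE normr0 expr0n eqxx.
apply/rowP => j; rewrite mxE; apply/eqP.
by have := u0 j (mem_index_enum _); rewrite expf_eq0 normr_eq0.
Qed.

Lemma normsq_le_dotxx n (u : 'rV[C]_n) j : `|u 0 j| ^+ 2 <= dot u u.
Proof.
by rewrite dotxx (bigD1 j) //= lerDl sumr_ge0 // => k _; rewrite exprn_ge0.
Qed.

Lemma dotDl n (u v w : 'rV[C]_n) : dot (u + v) w = dot u w + dot v w.
Proof. by rewrite /dot mulmxDl mxE. Qed.

Lemma dotZl n a (u v : 'rV[C]_n) : dot (a *: u) v = a * dot u v.
Proof. by rewrite /dot -scalemxAl mxE. Qed.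

Lemma dot_row_mx m n (a c : 'rV[C]_m) (b d : 'rV[C]_n) :
  dot (row_mx a b) (row_mx c d) = dot a c + dot b d.
Proof. by rewrite /dot tr_row_mx map_col_mx mul_row_col mxE. Qed.

Lemma dot_mulmx_adjoint m n (u : 'rV[C]_m) (v : 'rV[C]_n) (M : 'M[C]_(m, n)) :
  dot (u *m M) v = dot u (v *m M ^t*).
Proof. by rewrite /dot trmx_mul map_mxM /= trmxCK mulmxA. Qed.

(** Expand entrywise and use [|u_i| |v_j| <= |u_i|^2 + |v_j|^2]; the sum of the moduli of the
    entries of [M] is then a constant uniform in [u] and [v]. *)
Lemma norm_dot_mulmx_le m n (M : 'M[C]_(m, n)) : exists2 X, 0 <= X &
  forall (u : 'rV[C]_m) (v : 'rV[C]_n),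
    `|dot (u *m M) v| <= X * (dot u u + dot v v).
Proof.
exists (\sum_i \sum_j `|M i j|).
  by apply: sumr_ge0 => i _; apply: sumr_ge0.
move=> u v.
have -> : dot (u *m M) v = \sum_i \sum_j u 0 i * M i j * (v 0 j)^*.
  by rewrite dotE exchange_big; apply: eq_bigr => j _; rewrite mxE mulr_suml.
rewrite mulr_suml; apply: le_trans (ler_norm_sum _ _ _) _.
apply: ler_sum => i _; rewrite mulr_suml; apply: le_trans (ler_norm_sum _ _ _) _.
apply: ler_sum => j _; rewrite !normrM norm_conjC (mulrC `|u 0 i|) -mulrA.
apply: ler_wpM2l => //.
apply: le_trans (lerD (normsq_le_dotxx u i) (normsq_le_dotxx v j)).
have := normr_ge0 (u 0 i); have := normr_ge0 (v 0 j).
move: `|u 0 i| `|v 0 j| => a b b0 a0.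
rewrite -subr_ge0 (_ : _ - _ = ((a - b) ^+ 2 + a ^+ 2 + b ^+ 2) / 2); last by field.
have ab2 : 0 <= (a - b) ^+ 2 by rewrite real_exprn_even_ge0 // rpredB // ger0_real.
by rewrite divr_ge0 // !addr_ge0 // exprn_ge0.
Qed.

(** Negative definiteness of the Hermitian part of [N], a quantitative stability that tolerates
    small coupling blocks. *)
Definition dissipative n (N : 'M[C]_n) := exists2 e, 0 < e &
  forall u : 'rV[C]_n, 'Re (dot (u *m N) u) <= - e * dot u u.

(** The couplings contribute at most [c (X + Y) (p + q)], with [p], [q] the squared norms of the two
    components; for small [c] this is at most half of the decay [m (p + q)] due to the diagonal
    blocks. *)
Lemma dissipative_block n (s : C) (x : 'rV[C]_n) (y : 'cV[C]_n) (N : 'M[C]_n) :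
  'Re s < 0 -> dissipative N ->
  exists2 c, 0 < c & dissipative (block_mx s%:M (c *: x) (c *: y) N : 'M[C]_(1 + n)).
Proof.
move=> s_lt0 [e e0 He].
have [X X0 HX] := norm_dot_mulmx_le x; have [Y Y0 HY] := norm_dot_mulmx_le y.
(* [m] is the minimum of [- 'Re s] and [e], which are comparable because both are real. *)
have [m m0 /andP[ms me]] : exists2 m, 0 < m & (m <= - 'Re s) && (m <= e).
  have ns0 : 0 < - 'Re s by rewrite oppr_gt0.
  have /orP[le|le] := real_leVge (gtr0_real ns0) (gtr0_real e0).
    by exists (- 'Re s); rewrite // lexx.
  by exists e; rewrite // le lexx.
have D0 : 0 < 2 * (X + Y + 1) by rewrite mulr_gt0 // ltr_wpDl // addr_ge0.
pose c := m / (2 * (X + Y + 1)).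
have c0 : 0 < c by rewrite divr_gt0.
exists c => //; exists (m / 2); first by rewrite divr_gt0.
move=> w; rewrite -[w]hsubmxK; move: (lsubmx w) (rsubmx w) => a u.
rewrite (mul_row_block a u) !dot_row_mx !dotDl -!scalemxAr !dotZl mul_mx_scalar dotZl.
rewrite !raddfD /= ReMr ?ger0_real ?dotxx_ge0 //.
rewrite !ReMl ?gtr0_real //.
have le1 (z : C) : 'Re z <= `|z| by rewrite leif_Re_Creal.
have := le_trans (le1 _) (HX a u); have := le_trans (le1 _) (HY u a).
have := He u; have := dotxx_ge0 u; have := dotxx_ge0 a.
move: (dot a a) (dot u u) ('Re (dot (u *m N) u)) ('Re (dot (u *m y) a))
  ('Re (dot (a *m x) u)) => p q U V W p0 q0 hU hV hW.
have step1 : 'Re s * p <= - m * p by rewrite ler_wpM2r // lerNr.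
have step2 : c * V + c * W <= m / 2 * (p + q).
  rewrite -mulrDr; apply: le_trans (ler_wpM2l (ltW c0) (lerD hV hW)) _.
  rewrite (addrC q) -mulrDl mulrA ler_wpM2r ?addr_ge0 // /c.
  rewrite mulrAC ler_pdivrMr // (_ : m / 2 * _ = m * (X + Y + 1)); last by field.
  by apply: ler_wpM2l; [exact: ltW | rewrite addrC lerDl].
have step3 : U <= - m * q by apply: le_trans hU _; rewrite ler_wpM2r // lerN2.
rewrite (_ : - (m / 2) * (p + q) = - m * p + m / 2 * (p + q) + - m * q); last by field.
by rewrite (_ : _ + _ = 'Re s * p + (c * V + c * W) + U) ?lerD //; ring.
Qed.


(* The Popov-Belevitch-Hautus condition: [A] has no uncontrollable mode in the
   closed right half-plane. *)
Definition hautus n r (A : 'M[C]_n) (B : 'M[C]_(n, r)) :=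
  forall s (v : 'rV[C]_n), 0 <= 'Re s -> v *m A = s *: v -> v *m B = 0 -> v = 0.

(** [N] is the closed-loop matrix in another basis; the similarity [T] later supplies the Lyapunov
    matrix. *)
Definition dissipatable n r (A : 'M[C]_n) (B : 'M[C]_(n, r)) :=
  exists K (T N : 'M[C]_n),
    [/\ T \in unitmx, T *m (A + B *m K) = N *m T & dissipative N].

(** * From the Hautus condition to a dissipative closed loop *)

Lemma deflation n (A : 'M[C]_(1 + n)) : exists T s a (A' : 'M[C]_n),
  T \in unitmx /\ T *m A = (block_mx s%:M a 0 A' : 'M[C]_(1 + n)) *m T.
Proof.
(* A row eigenvector of [A^T] is a column eigenvector of [A]; completed to a basis by [row_ebase],
   it becomes the first basis vector. *)
have [s /eigenvalueP[v vA v0]] := eigenvalue_closed A^T (ltn0Sn n).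
pose Q := row_ebase v; pose e : 'rV[C]_(1 + n) := row_mx 1%:M 0.
have Qu : Q \in unitmx by rewrite row_ebase_unit.
have vE : v = col_ebase v 0 0 *: (e *m Q).
  rewrite -{1}[v]mulmx_ebase rank_rV v0 {1}[col_ebase v]mx11_scalar -mulmxA.
  rewrite mul_scalar_mx; congr (_ *: (_ *m _)).
  by rewrite -[RHS]/(row_mx 1%:M 0) pid_mx_row.
have c0 : col_ebase v 0 0 != 0.
  by apply: contra_neq v0 => c0; rewrite vE c0 scale0r.
have eA : e *m (Q *m A^T *m invmx Q) = s *: e.
  have {1}-> : e = (col_ebase v 0 0)^-1 *: v *m invmx Q.
    by rewrite {2}vE scalerA mulVf // scale1r mulmxK.
  rewrite -!mulmxA (mulmxA (invmx Q) Q) mulVmx // mul1mx mulmxA -scalemxAl vA.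
  rewrite scalerA mulrC -scalerA -scalemxAl; congr (_ *: _).
  by rewrite {2}vE scalerA mulVf // scale1r mulmxK.
pose M := (Q *m A^T *m invmx Q)^T.
have M1 : M *m (col_mx 1%:M 0 : 'cV[C]_(1 + n)) = s *: col_mx 1%:M 0.
  have -> : col_mx 1%:M 0 = e^T :> 'cV[C]_(1 + n) by rewrite tr_row_mx trmx1 trmx0.
  by rewrite -trmx_mul eA linearZ.
pose M' : 'M[C]_(1 + n) := M; have {M1} : M' *m col_mx 1%:M 0 = s *: col_mx 1%:M 0 by [].
have : invmx Q^T *m A = M' *m invmx Q^T.
  by rewrite /M' /M !trmx_mul trmxK trmx_inv -!mulmxA mulmxV ?mulmx1 ?unitmx_tr.
rewrite -[M']submxK mul_block_col !mulmx1 !mulmx0 !addr0 scale_col_mx scaler0.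
rewrite scalemx1 => QA /eq_col_mx[M'ul M'dl]; rewrite M'ul M'dl in QA.
exists (invmx Q^T), s, (ursubmx M'), (drsubmx M').
by split => //; rewrite unitmx_inv unitmx_tr.
Qed.

Lemma hautus_similar n r (A A0 T : 'M[C]_n) (B : 'M[C]_(n, r)) :
  T \in unitmx -> T *m A = A0 *m T -> hautus A B -> hautus A0 (T *m B).
Proof.
move=> Tu TA hAB s v s0 vA vB; have /(congr1 (mulmx^~ (invmx T))) : v *m T = 0.
  apply: (hAB s) => //; last by rewrite -mulmxA.
  by rewrite -mulmxA TA mulmxA vA scalemxAl.
by rewrite mulmxK // mul0mx.
Qed.

Lemma hautus_feedback n r (A : 'M[C]_n) (B : 'M[C]_(n, r)) K :
  hautus A B -> hautus (A + B *m K) B.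
Proof.
move=> hAB s v s0 vA vB; apply: (hAB s) => //.
by rewrite -vA mulmxDr mulmxA vB mul0mx addr0.
Qed.

(** Padding a row eigenvector of the corner [A] with a leading zero gives one of the whole
    triangular matrix. *)
Lemma hautus_drsubmx n r s a (A : 'M[C]_n) b (B : 'M[C]_(n, r)) :
  hautus (block_mx s%:M a 0 A : 'M[C]_(1 + n)) (col_mx b B) -> hautus A B.
Proof.
move=> hAB t v t0 vA vB.
have /eq_row_mx[_ //] : row_mx (0 : 'rV[C]_1) v = row_mx 0 0.
rewrite row_mx0; apply: (hAB t) => //.
  by rewrite (mul_row_block 0 v) !mul0mx mulmx0 !add0r vA scale_row_mx scaler0.
by rewrite mul_row_col vB mul0mx addr0.
Qed.

Lemma dissipatable_similar n r (A A0 T : 'M[C]_n) (B : 'M[C]_(n, r)) :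
  T \in unitmx -> T *m A = A0 *m T ->
  dissipatable A0 (T *m B) -> dissipatable A B.
Proof.
move=> Tu TA [K [S [N [Su SA dN]]]].
exists (K *m T), (S *m T), N; split => //; first by rewrite unitmx_mul Su.
have TAK : T *m (A + B *m (K *m T)) = (A0 + T *m B *m K) *m T.
  by rewrite mulmxDr mulmxDl TA !mulmxA.
by rewrite -mulmxA TAK !mulmxA SA.
Qed.

Lemma dissipatable_feedback n r (A : 'M[C]_n) (B : 'M[C]_(n, r)) K :
  dissipatable (A + B *m K) B -> dissipatable A B.
Proof.
move=> [K' [S [N [Su SA dN]]]].
by exists (K + K'), S, N; split => //; rewrite mulmxDr addrA.
Qed.

Lemma dissipative_Re_lt0 n (N : 'M[C]_n) s (u : 'rV[C]_n) :
  dissipative N -> u *m N = s *: u -> u != 0 -> 'Re s < 0.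
Proof.
move=> [e e0 He] uN u0; have := He u; rewrite uN dotZl.
have uu : 0 < dot u u by rewrite lt_def dotxx_eq0 u0 dotxx_ge0.
rewrite ReMr ?gtr0_real // ler_pM2r // => /le_lt_trans -> //.
by rewrite oppr_lt0.
Qed.

(* If [s] is already stable, shrinking the first coordinate makes the coupling
   [a] negligible.  Otherwise [s] is not an eigenvalue of [A], so it has a left
   eigenvector [v], and the rank-one feedback [k *m v] moves [s] to -1 while
   keeping the remaining block. *)
Lemma dissipatable_block n r s a (A T N : 'M[C]_n) b (B : 'M[C]_(n, r)) :
  T \in unitmx -> T *m A = N *m T -> dissipative N ->
  hautus (block_mx s%:M a 0 A : 'M[C]_(1 + n)) (col_mx b B) ->
  dissipatable (block_mx s%:M a 0 A : 'M[C]_(1 + n)) (col_mx b B).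
Proof.
move=> Tu TA dN hAB; have Rs := Creal_Re s.
have [s_ge0|s_lt0] := real_leP (real0 C) Rs; last first.
  (* Zero feedback suffices: the change of basis [diag(c, T)] replaces [a] by [c a T^-1]. *)
  have [c c0 dM] := dissipative_block (a *m invmx T) 0 s_lt0 dN.
  exists 0, (block_mx c%:M 0 0 T), (block_mx s%:M (c *: (a *m invmx T)) (c *: 0) N).
  split => //.
    by rewrite unitmxE (@det_ublock _ 1 n) det_scalar1 unitrM unitfE gt_eqF.
  rewrite mulmx0 addr0 scaler0 !mulmx_block !mul0mx !mulmx0 !addr0 !add0r TA.
  by rewrite scalar_mxC -scalemxAl mulmxKV // (mul_scalar_mx c a).
have sA : A - s%:M \in unitmx.
  rewrite -row_free_unit -kermx_eq0; apply/negPn/negP => As.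
  have /eigenvalueP[u uA u0] : eigenvalue A s by [].
  suff: 'Re s < 0 by move/lt_geF; rewrite s_ge0.
  apply: (dissipative_Re_lt0 (u := u *m invmx T) dN).
    by rewrite -(mulmxK Tu N) -TA -!mulmxA mulKmx // !mulmxA uA scalemxAl.
  by apply: contra_neq u0 => /(congr1 (mulmx^~ T)); rewrite mulmxKV // mul0mx.
(* Solves [a + x A = s x], so that [(1, x)] is a left eigenvector for [s]. *)
pose x := - a *m invmx (A - s%:M).
have xA : a + x *m A = s *: x.
  have : x *m (A - s%:M) = - a by rewrite mulmxKV.
  by rewrite mulmxBr mul_mx_scalar => /eqP;
    rewrite subr_eq => /eqP ->; rewrite addrA subrr add0r.
pose v : 'rV[C]_(1 + n) := row_mx 1%:M x.
(* By the Hautus condition the input reaches the mode [v]; with this [k] the feedback [k v] sends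
   [v] to [s v + (- s - 1) v = - v]. *)
have [k vBk] : exists k : 'cV[C]_r, v *m col_mx b B *m k = (- s - 1)%:M.
  have /rV0Pn[j vBj] : v *m col_mx b B != 0.
    apply: contraTneq (oner_neq0 C) => vB0; rewrite negbK.
    have /eq_row_mx[/matrixP/(_ 0 0) + _] : row_mx 1%:M x = row_mx 0 0.
      rewrite row_mx0; apply: (hAB s) => //.
      rewrite (mul_row_block _ x) mulmx0 addr0 !mul1mx xA scale_row_mx.
      by rewrite scalemx1.
    by rewrite !mxE /= => /eqP.
  exists (((- s - 1) / (v *m col_mx b B) 0 j) *: delta_mx j 0).
  rewrite -scalemxAr -colE [col j _]mx11_scalar !mxE /= -scalemx1 scalerA.
  by rewrite mxE in vBj; rewrite divfK // scalemx1.
have [|c c0 dM] := dissipative_block (s := - 1) 0 (T *m B *m k) _ dN.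
  by rewrite raddfN /= (Creal_ReP _ _) ?oppr_lt0.
(* The unipotent factor makes [v] the first basis row, which gives [[[-1, 0], [B k, A]]]; then
   [diag(1, c T)] turns [A] into [N] and scales the coupling by [c]. *)
exists (k *m v), (block_mx 1%:M 0 0 (c *: T) *m block_mx 1%:M x 0 1%:M).
exists (block_mx (-1)%:M (c *: 0) (c *: (T *m B *m k)) N).
split => //.
  rewrite unitmx_mul !unitmxE (@det_ublock _ 1 n) (@det_ublock _ 1 n 1).
  rewrite !det1 mulr1 unitr1 andbT.
  by rewrite mul1r detZ unitrM unitrX /= -?unitmxE // unitfE gt_eqF.
have vE : v = row_mx 1%:M 0 *m block_mx 1%:M x 0 1%:M.
  by rewrite (mul_row_block 1%:M 0) !mul1mx !mul0mx !addr0.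
have -> : block_mx 1%:M 0 0 (c *: T) *m block_mx 1%:M x 0 1%:M *m
   (block_mx s%:M a 0 A + col_mx b B *m (k *m v)) =
   block_mx 1%:M 0 0 (c *: T) *m
   (block_mx s%:M 0 0 A + col_mx (-s - 1)%:M (B *m k) *m row_mx 1%:M 0) *m
   block_mx 1%:M x 0 1%:M :> 'M[C]_(1 + n).
  rewrite -!mulmxA; congr (_ *m _); rewrite mulmxDr mulmxDl; congr (_ + _).
    rewrite !mulmx_block !mul1mx !mul0mx !mulmx0 !addr0 !add0r mulmx1.
    by rewrite mulmx1 mul_scalar_mx xA.
  rewrite -mulmxA -vE !mulmxA; congr (_ *m _).
  by rewrite mul_block_col mul_col_mx -vBk mul_row_col mul0mx add0r !mul1mx.
rewrite mulmxA; congr (_ *m _).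
rewrite mul_col_row add_block_mx !mulmx0 !addr0 !mulmx1 add0r -raddfD /=.
rewrite (_ : s + (- s - 1) = - 1); last by ring.
rewrite !mulmx_block !mul0mx !mulmx0 !addr0 !add0r !mulmx1 !mul1mx scaler0 mul0mx.
by rewrite -!scalemxAl -scalemxAr mulmxA TA.
Qed.

Theorem hautus_dissipatable n r (A : 'M[C]_n) (B : 'M[C]_(n, r)) :
  hautus A B -> dissipatable A B.
Proof.
elim: n => [|n IH] in A B *.
  move=> _; exists 0, 1%:M, A; split; rewrite ?unitmx1 ?mulmx1 ?mul1mx ?mulmx0 ?addr0 //.
  exists 1 => // u; rewrite (_ : u = 0); last by apply/rowP => -[].
  by rewrite mul0mx /dot mul0mx mxE mulr0 raddf0.
move=> hAB; have [T [s [a [A' [Tu TA]]]]] := deflation A.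
apply: (dissipatable_similar Tu TA); move: (hautus_similar Tu TA hAB).
rewrite -[T *m B](@vsubmxK _ 1 n); move: (usubmx _) (dsubmx _) => b B' hAB'.
have [K [S [N [Su SA dN]]]] := IH _ _ (hautus_drsubmx hAB').
(* The inductive feedback acts first, on the trailing block alone; the deflated eigenvalue is
   treated afterwards. *)
apply: (@dissipatable_feedback _ _ _ _ (row_mx 0 K)).
have fE : block_mx s%:M a 0 A' + col_mx b B' *m row_mx 0 K =
    block_mx s%:M (a + b *m K) 0 (A' + B' *m K) :> 'M[C]_(1 + n).
  by rewrite mul_col_row add_block_mx !mulmx0 !addr0.
by rewrite fE; apply: (dissipatable_block Su SA dN); rewrite -fE; apply: hautus_feedback.
Qed.

End Dissipative.

(** * Real Lyapunov inequalities *)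

Section RealForms.
Local Open Scope sesquilinear_scope.
Local Open Scope complex_scope.
Variable R : realType.

(** * Real quadratic forms and entrywise real parts *)

Definition quad n (S : 'M[R]_n) (u : 'rV[R]_n) : R := (u *m S *m u^T) 0 0.

Lemma quad1 n (u : 'rV[R]_n) : quad 1%:M u = \sum_j u 0 j ^+ 2.
Proof. by rewrite /quad mulmx1 mxE; apply: eq_bigr => j _; rewrite mxE. Qed.

Lemma quad1_ge0 n (u : 'rV[R]_n) : 0 <= quad 1%:M u.
Proof. by rewrite quad1 sumr_ge0 // => j _; rewrite sqr_ge0. Qed.

Lemma quad1_eq0 n (u : 'rV[R]_n) : (quad 1%:M u == 0) = (u == 0).
Proof.
rewrite quad1 psumr_eq0; last by move=> j _; rewrite sqr_ge0.
apply/allP/eqP => [u0|-> j _]; last by rewrite mxE expr0n eqxx.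
apply/rowP => j; rewrite mxE; apply/eqP.
by have := u0 j (mem_index_enum _); rewrite sqrf_eq0.
Qed.

Definition Rmx m n (M : 'M[R[i]]_(m, n)) : 'M[R]_(m, n) :=
  map_mx (@complex.Re R) M.
Definition Imx m n (M : 'M[R[i]]_(m, n)) : 'M[R]_(m, n) :=
  map_mx (@complex.Im R) M.

Lemma ReM_real (x : R) (z : R[i]) : complex.Re (x%:C * z) = x * complex.Re z.
Proof. by case: z => a b /=; rewrite mul0r subr0. Qed.

Lemma ImM_real (x : R) (z : R[i]) : complex.Im (x%:C * z) = x * complex.Im z.
Proof. by case: z => a b /=; rewrite mul0r addr0. Qed.

Lemma Rmx_mulr m n p (M : 'M[R[i]]_(m, n)) (X : 'M[R]_(n, p)) :
  Rmx (M *m Cmx X) = Rmx M *m X.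
Proof.
apply/matrixP => i j; rewrite !mxE raddf_sum; apply: eq_bigr => k _.
by rewrite !mxE [RHS]mulrC -ReM_real mulrC.
Qed.

Lemma Rmx_mull m n p (X : 'M[R]_(m, n)) (M : 'M[R[i]]_(n, p)) :
  Rmx (Cmx X *m M) = X *m Rmx M.
Proof.
apply/matrixP => i j; rewrite !mxE raddf_sum; apply: eq_bigr => k _.
by rewrite !mxE -ReM_real.
Qed.

Lemma Imx_mulr m n p (M : 'M[R[i]]_(m, n)) (X : 'M[R]_(n, p)) :
  Imx (M *m Cmx X) = Imx M *m X.
Proof.
apply/matrixP => i j; rewrite !mxE raddf_sum; apply: eq_bigr => k _.
by rewrite !mxE [RHS]mulrC -ImM_real mulrC.
Qed.

Lemma Cmx_adj m n (X : 'M[R]_(m, n)) : (Cmx X) ^t* = Cmx X^T.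
Proof. by apply/matrixP => i j; rewrite !mxE conj_Creal // complex_real. Qed.

(** Real and imaginary parts of [v M = s v] for a complex row eigenvector [v = a + i b]. *)
Lemma real_eigenvectors n (M : 'M[R]_n) s : eigenvalue (Cmx M) s ->
  exists a b : 'rV[R]_n, [/\ (a != 0) || (b != 0),
    a *m M = complex.Re s *: a - complex.Im s *: b &
    b *m M = complex.Im s *: a + complex.Re s *: b].
Proof.
case/eigenvalueP => v vM v0; exists (Rmx v), (Imx v); split.
- rewrite -negb_and; apply: contra v0 => /andP[/eqP/rowP a0 /eqP/rowP b0].
  apply/eqP/rowP => j; have := a0 j; have := b0 j; rewrite !mxE.
  by case: (v 0 j) => x y /= -> ->.
- rewrite -Rmx_mulr vM; apply/rowP => j; rewrite !mxE.
  by case: (v 0 j) s {vM} => x y [p q].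
- rewrite -Imx_mulr vM; apply/rowP => j; rewrite !mxE.
  by case: (v 0 j) s {vM} => x y [p q] /=; ring.
Qed.

Lemma Re_dot_Cmx n (S : 'M[R[i]]_n) (u : 'rV[R]_n) :
  complex.Re (dot (Cmx u *m S) (Cmx u)) = quad (Rmx S) u.
Proof. by rewrite /quad -Rmx_mull -Rmx_mulr /dot Cmx_adj [RHS]mxE. Qed.

(* With [T (A + B K) T^-1] dissipative, [Q = T^-1 (T^-1)^*] and [K Q] solve the
   complex Lyapunov inequality.  It is linear in the pair [(Q, K Q)] and [A], [B]
   are real, so the entrywise real parts still solve it. *)
Lemma hautus_real_lmi n r (A : 'M[R]_n) (B : 'M[R]_(n, r)) :
  hautus (Cmx A) (Cmx B) -> exists P Y e e', [/\ 0 < e, 0 < e', P^T = P,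
    forall u, e' * quad 1%:M u <= quad P u &
    forall u, quad (A *m P + B *m Y) u <= - e * quad P u].
Proof.
case/hautus_dissipatable => K [T [N [Tu TAN [e e0 He]]]].
have [X X0 HX] := norm_dot_mulmx_le (T *m T ^t*).
pose Q := invmx T *m (invmx T) ^t*.
have dotQ u : dot (Cmx u *m Q) (Cmx u) = dot (Cmx u *m invmx T) (Cmx u *m invmx T).
  by rewrite mulmxA dot_mulmx_adjoint trmxCK.
have real_ge0 (z : R[i]) : 0 <= z -> z = (complex.Re z)%:C.
  by case: z => x y; rewrite lecE /= => /andP[/eqP ->].
(* With [g = u T^-1], the form of [Q] at [u] is [|g|^2], while [|u|^2 <= 2 X |g|^2]; adding 1 to
   [2 X] keeps the denominator of [e'] positive. *)
exists (Rmx Q), (Rmx (K *m Q)), (complex.Re e), (2 * complex.Re X + 1)^-1.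
have RX0 : 0 <= complex.Re X by move: X0; rewrite lecE => /andP[].
split.
- by move: e0; rewrite ltcE => /andP[].
- by rewrite invr_gt0 ltr_wpDl // mulr_ge0.
(* [Q] is Hermitian, so its real part is symmetric. *)
- apply/matrixP => i j; rewrite [LHS]mxE [LHS]mxE [RHS]mxE.
  have -> : Q j i = Num.conj ((Q ^t*) i j) by rewrite !mxE conjCK.
  rewrite trmx_mul map_mxM /= trmxCK.
  by case: (_ i j).
- move=> u; rewrite -Re_dot_Cmx dotQ ler_pdivrMl ?ltr_wpDl // ?mulr_ge0 //.
  have [g gE] : exists g, g = Cmx u *m invmx T by exists (Cmx u *m invmx T).
  have uE : Cmx u = g *m T by rewrite gE mulmxKV.
  have -> : quad 1%:M u = complex.Re (dot (Cmx u) (Cmx u)).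
    rewrite -[X in dot X _]mulmx1 Re_dot_Cmx; congr quad.
    by apply/matrixP => i j; rewrite !mxE; case: (i == j).
  have := le_trans (real_ler_norm _) (HX g g); rewrite mulmxA dot_mulmx_adjoint trmxCK.
  rewrite -uE -gE => /(_ (ger0_real (dotxx_ge0 _))).
  rewrite {1}[dot (Cmx u) _]real_ge0 ?dotxx_ge0 // [dot g g]real_ge0 ?dotxx_ge0 //.
  rewrite [X]real_ge0 // -rmorphD -rmorphM lecR /=.
  have := dotxx_ge0 g; rewrite lecE => /andP[_ /=].
  by set d := complex.Re (dot g g) => d0; lra.
- move=> u; rewrite -!Rmx_mull -map_mxD -!Re_dot_Cmx dotQ.
  (* Hence [(A + B K) Q = T^-1 N (T^-1)^*], and the claim is dissipativity of [N] at [u T^-1]. *)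
  have ABE : Cmx A + Cmx B *m K = invmx T *m (N *m T) by rewrite -TAN mulKmx.
  rewrite (mulmxA _ K) -mulmxDl ABE -mulmxA /Q (mulmxA (N *m T)) mulmxK //.
  rewrite !mulmxA dot_mulmx_adjoint trmxCK.
  have := He (Cmx u *m invmx T); rewrite -complexRe.
  rewrite {1}[e]real_ge0 ?(ltW e0) //.
  rewrite [dot (_ *m invmx T) (_ *m invmx T)]real_ge0 ?dotxx_ge0 //.
  by rewrite -(rmorphN (real_complex R)) -rmorphM lecR.
Qed.


Lemma quadC n (S : 'M[R]_n) (a b : 'rV[R]_n) : S^T = S ->
  (a *m S *m b^T) 0 0 = (b *m S *m a^T) 0 0.
Proof.
move=> symS; transitivity ((a *m S *m b^T)^T 0 0); first by rewrite [RHS]mxE.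
by rewrite !trmx_mul trmxK symS mulmxA.
Qed.

(** Add the inequalities at the real and imaginary parts of an eigenvector: by symmetry of [P] the
    terms in [Im s] cancel, leaving [Re s] times a positive number. *)
Lemma lmi_hurwitz n (M P : 'M[R]_n) e e' : 0 < e -> 0 < e' -> P^T = P ->
  (forall u, e' * quad 1%:M u <= quad P u) ->
  (forall u, quad (M *m P) u <= - e * quad P u) -> hurwitz M.
Proof.
move=> e0 e'0 symP Ppos HM s /real_eigenvectors[a [b [ab0 aM bM]]].
have P_ge0 u : 0 <= quad P u.
  by apply: le_trans (Ppos u); rewrite mulr_ge0 ?quad1_ge0 // ltW.
have P_gt0 u : u != 0 -> 0 < quad P u.
  move=> u0; apply: lt_le_trans (Ppos u); rewrite mulr_gt0 // lt_def quad1_ge0.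
  by rewrite quad1_eq0 u0.
have Pab : 0 < quad P a + quad P b.
  by case/orP: ab0 => ?; [apply: ltr_wpDr | apply: ltr_wpDl]; rewrite ?P_ge0 ?P_gt0.
have := lerD (HM a) (HM b); rewrite /quad !mulmxA aM bM !mulmxDl !mulNmx -!scalemxAl.
move: Pab; rewrite /quad; have := quadC a b symP; rewrite !mxE.
set x := \sum_j _; set y := \sum_j _; set p := \sum_j _; set q := \sum_j _ => ->.
move=> pq0 h; rewrite -(pmulr_llt0 _ pq0); apply: le_lt_trans (_ : - e * (p + q) < 0).
  by lra.
by rewrite mulNr oppr_lt0 mulr_gt0.
Qed.

(** A left eigenvector killed by [B] survives every feedback, hence necessity; sufficiency goes
    through the real Lyapunov inequality. *)
Lemma stabilizable_hautus n r (A : 'M[R]_n) (B : 'M[R]_(n, r)) :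
  stabilizable A B <-> hautus (Cmx A) (Cmx B).
Proof.
split=> [[K hK] s v|/hautus_real_lmi[P [Y [e [e' [e0 e'0 symP Ppos HM]]]]]].
  rewrite -complexRe lecR => s_ge0 vA vB; apply/eqP/negPn/negP => v0.
  suff /hK : eigenvalue (Cmx (A + B *m K)) s by rewrite ltNge s_ge0.
  apply/eigenvalueP; exists v => //.
  by rewrite /Cmx map_mxD map_mxM mulmxDr mulmxA vA vB mul0mx addr0.
have Pu : P \in unitmx.
  rewrite -row_free_unit -kermx_eq0; apply/eqP/row_matrixP => i; rewrite row0.
  apply/eqP; rewrite -quad1_eq0 eq_le quad1_ge0 andbT -(pmulr_rle0 _ e'0).
  apply: le_trans (Ppos _) _.
  by rewrite /quad -row_mul mulmx_ker row0 mul0mx mxE.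
(* Chosen so that [(A + B K) P = A P + B Y]. *)
exists (Y *m invmx P); apply: (lmi_hurwitz e0 e'0 symP Ppos) => u.
by rewrite mulmxDl -!mulmxA mulVmx // mulmx1.
Qed.

(** Lyapunov's theorem, as the case of a system with zero inputs. *)
Lemma hurwitz_lmi n (M : 'M[R]_n) : hurwitz M -> exists P e e',
  [/\ 0 < e, 0 < e', P^T = P, forall u, e' * quad 1%:M u <= quad P u &
    forall u, quad (M *m P) u <= - e * quad P u].
Proof.
move=> hM; have /hautus_real_lmi : hautus (Cmx M) (Cmx (0 : 'M[R]_(n, 0))).
  by apply/stabilizable_hautus; exists 0; rewrite mul0mx addr0.
case=> P [Y [e [e' [? ? ? ? HM]]]]; exists P, e, e'; split => // u.
by have := HM u; rewrite mul0mx addr0.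
Qed.

Lemma eigenvalue_unitmx (F : fieldType) n (M : 'M[F]_n) s :
  eigenvalue M s = (M - s%:M \notin unitmx).
Proof. by rewrite -row_free_unit -kermx_eq0. Qed.

(** Links the row-vector forms used above to trajectories, which are columns. *)
Lemma hurwitz_tr n (M : 'M[R]_n) : hurwitz M -> hurwitz M^T.
Proof.
move=> hM s; rewrite eigenvalue_unitmx => Ms; apply: hM.
rewrite eigenvalue_unitmx; apply: contra Ms; rewrite -unitmx_tr.
by rewrite raddfB /= tr_scalar_mx /Cmx map_trmx.
Qed.

End RealForms.

(** * Linear differential systems *)

Section Analysis.
Local Open Scope classical_set_scope.
Variable R : realType.

(** * Entrywise derivatives and limits of matrix functions *)

Lemma is_derive_mxP m n (M : R -> 'M[R]_(m, n)) (dM : 'M[R]_(m, n)) t :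
  is_derive t (1 : R) M dM <->
  forall i j, is_derive t (1 : R) (fun s => M s i j) (dM i j).
Proof.
split=> [[Mt <-] i j|H].
  by rewrite derive_mx // mxE; apply: DeriveDef => //; exact: ((derivable_mxP M t 1).1 Mt).
have Mt : derivable M t 1 by apply/derivable_mxP => i j; have [] := H i j.
apply: DeriveDef => //; rewrite derive_mx //; apply/matrixP => i j; rewrite mxE.
by have [_ ->] := H i j.
Qed.

Lemma cvg_mxP T (F : set_system T) {FF : Filter F} m n
    (f : T -> 'M[R]_(m, n)) (l : 'M[R]_(m, n)) :
  f x @[x --> F] --> l <->
  forall i j, f x i j @[x --> F] --> l i j.
Proof.
split=> [fl i j|H].
  exact: (cvg_comp _ _ fl (@coord_continuous R m n i j l)).
apply/cvgrPdist_le => /= e e0; near=> x.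
rewrite /Num.Def.normr/= mx_normrE (bigmax_le _ (ltW e0))//= => i _.
rewrite !mxE/=.
move: i; near: x; apply: filter_forall => /= i.
exact: ((cvgrPdist_le _ _).1 (H i.1 i.2)).
Unshelve. all: by end_near. Qed.

Lemma is_derive_mulmx m n p (F : R -> 'M[R]_(m, n)) (G : R -> 'M[R]_(n, p)) t dF dG :
  is_derive t (1 : R) F dF -> is_derive t (1 : R) G dG ->
  is_derive t (1 : R) (fun s => F s *m G s) (dF *m G t + F t *m dG).
Proof.
move=> /is_derive_mxP HF /is_derive_mxP HG; apply/is_derive_mxP => i j.
rewrite (_ : (fun s => _) = \sum_k (fun s => F s i k * G s k j)); last first.
  by apply/funext => s; rewrite fct_sumE mxE.
rewrite !mxE -big_split /=; apply: is_derive_sum => k.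
have HFk := HF i k; have HGk := HG k j.
apply: (is_derive_eq (is_deriveM HFk HGk)).
by rewrite /GRing.scale /=; ring.
Qed.

Lemma is_derive_trmx m n (F : R -> 'M[R]_(m, n)) t dF :
  is_derive t (1 : R) F dF -> is_derive t (1 : R) (fun s => (F s)^T) dF^T.
Proof.
move=> /is_derive_mxP HF; apply/is_derive_mxP => i j.
rewrite mxE (_ : (fun s => _) = (fun s => F s j i)) //.
by apply/funext => s; rewrite mxE.
Qed.

Lemma is_derive_col_mx m n p (F : R -> 'M[R]_(m, p)) (G : R -> 'M[R]_(n, p)) t dF dG :
  is_derive t (1 : R) (fun s => col_mx (F s) (G s)) (col_mx dF dG) <->
  is_derive t (1 : R) F dF /\ is_derive t (1 : R) G dG.
Proof.
split=> [/is_derive_mxP H|[/is_derive_mxP HF /is_derive_mxP HG]].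
  split; apply/is_derive_mxP => i j.
    have := H (lshift n i) j; rewrite col_mxEu (_ : (fun s => _) = (fun s => F s i j)) //.
    by apply/funext => s; rewrite col_mxEu.
  have := H (rshift m i) j; rewrite col_mxEd (_ : (fun s => _) = (fun s => G s i j)) //.
  by apply/funext => s; rewrite col_mxEd.
apply/is_derive_mxP => i j; case: (split_ordP i) => k ->.
  rewrite col_mxEu (_ : (fun s => _) = (fun s => F s k j)) //.
  by apply/funext => s; rewrite col_mxEu.
rewrite col_mxEd (_ : (fun s => _) = (fun s => G s k j)) //.
by apply/funext => s; rewrite col_mxEd.
Qed.

Lemma cvg_mulmxl T (F : set_system T) {FF : Filter F} m n p (A : 'M[R]_(m, n))
    (f : T -> 'M[R]_(n, p)) (l : 'M[R]_(n, p)) :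
  f x @[x --> F] --> l -> A *m f x @[x --> F] --> A *m l.
Proof.
move=> /cvg_mxP H; apply/cvg_mxP => i j; rewrite mxE.
under eq_fun do rewrite mxE.
apply: cvg_big => [|k _]; first exact: add_continuous.
apply: cvgMl_tmp; exact: H.
Qed.

Lemma cvg_col_mx T (F : set_system T) {FF : Filter F} m n p
    (f : T -> 'M[R]_(m, p)) (g : T -> 'M[R]_(n, p)) (a : 'M[R]_(m, p)) (b : 'M[R]_(n, p)) :
  col_mx (f x) (g x) @[x --> F] --> col_mx a b <->
  f x @[x --> F] --> a /\ g x @[x --> F] --> b.
Proof.
split=> [/cvg_mxP H|[/cvg_mxP Hf /cvg_mxP Hg]].
  split; apply/cvg_mxP => i j.
    have := H (lshift n i) j; rewrite col_mxEu.
    by under eq_fun do rewrite col_mxEu.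
  have := H (rshift m i) j; rewrite col_mxEd.
  by under eq_fun do rewrite col_mxEd.
apply/cvg_mxP => i j; case: (split_ordP i) => k ->.
  by rewrite col_mxEu; under eq_fun do rewrite col_mxEu; exact: Hf.
by rewrite col_mxEd; under eq_fun do rewrite col_mxEd; exact: Hg.
Qed.

(** * Decay of trajectories and the Hurwitz property *)

Lemma is_derive_mulrl (c t : R) : is_derive t (1 : R) ( *%R c) c.
Proof.
apply: (is_derive_eq (is_deriveZ c (is_derive_id t 1))).
by rewrite /GRing.scale /= mulr1.
Qed.

(** [V t * expR (c * t)] is nonincreasing, so [V] is squeezed between 0 and
    [V 0 * expR (- (c * t))]. *)
Lemma exponential_decay (V dV : R -> R) (c : R) : 0 < c ->
  (forall t : R, 0 <= t -> is_derive t (1 : R) V (dV t)) ->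
  (forall t : R, 0 <= t -> 0 <= V t) ->
  (forall t : R, 0 <= t -> dV t <= - c * V t) -> V t @[t --> +oo] --> 0.
Proof.
move=> c0 HV V0 HdV.
pose g t := V t * expR (c * t).
have Hg (t : R) : 0 <= t -> is_derive t (1 : R) g (expR (c * t) * (dV t + c * V t)).
  move=> t0; have := HV _ t0 => Vt.
  have Et : is_derive t (1 : R) (fun t => expR (c * t)) (expR (c * t) * c).
    by apply: (is_derive1_comp (f := expR)); exact: is_derive_mulrl.
  by apply: (is_derive_eq (is_deriveM Vt Et)); rewrite /GRing.scale /=; ring.
have gle (t : R) : 0 <= t -> g t <= g 0.
  move=> t0; apply: (@ler0_derive1_nincry R g 0) => // [x|x|].
  - by rewrite in_itv /= andbT => /ltW /Hg [].
  - rewrite in_itv /= andbT => /ltW x0; rewrite derive1E; have [_ ->] := Hg _ x0.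
    by rewrite pmulr_rle0 ?expR_gt0 //; have := HdV _ x0; lra.
  apply: derivable_within_continuous => x; rewrite in_itv /= andbT => /Hg [].
  by [].
have ct : (c * t : R) @[t --> +oo] --> +oo.
  apply/cvgryPge => A; near=> t.
  by rewrite mulrC -ler_pdivrMr //; near: t; exact: nbhs_pinfty_ge.
apply: (@squeeze_cvgr _ _ _ _ (fun=> 0) (fun t => V 0 * expR (- (c * t)))).
- near=> t; have t0 : 0 <= t by [].
  rewrite V0 //=; have := gle _ t0; rewrite /g mulr0 expR0 mulr1 => h.
  by rewrite expRN ler_pdivlMr ?expR_gt0.
- exact: cvg_cst.
have := cvgMl_tmp (a := V 0) (cvg_comp _ _ ct (@cvgr_expR R)); rewrite mulr0; exact.
Unshelve. all: end_near. Qed.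

Theorem hurwitz_cvg0 n (M : 'M[R]_n) (x : R -> 'cV[R]_n) : hurwitz M ->
  (forall t : R, 0 <= t -> is_derive t (1 : R) x (M *m x t)) ->
  x t @[t --> +oo] --> (0 : 'cV[R]_n).
Proof.
move=> /hurwitz_tr /hurwitz_lmi[P [e [e' [e0 e'0 symP Ppos HM]]]] Hx.
(* The Lyapunov function [x^T P x], with [P] taken for [M^T]; its derivative is twice the form of
   [M^T P]. *)
pose V t := quad P (x t)^T.
have V_ge0 t : 0 <= V t.
  by apply: le_trans (Ppos _); rewrite mulr_ge0 ?quad1_ge0 // ltW.
have Vcvg : V t @[t --> +oo] --> 0.
  apply: (@exponential_decay V (fun t => 2 * quad (M^T *m P) (x t)^T) (2 * e)).
  - by rewrite mulr_gt0.
  - move=> t t0; have Ht := Hx _ t0.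
    have H1 := is_derive_mulmx (is_derive_trmx Ht) (is_derive_cst P t 1).
    have /is_derive_mxP/(_ 0 0) := is_derive_mulmx H1 Ht.
    rewrite (_ : (fun s => _) = V); last first.
      by apply/funext => s; rewrite /V /quad trmxK.
    move/is_derive_eq; apply.
    rewrite mulmx0 addr0 trmx_mul mxE /quad trmxK (mulmxA _ M^T P) mulr2n mulrDl !mul1r.
    congr (_ + _). rewrite !mulmxA.
    transitivity (((x t)^T *m P *m M *m x t)^T 0 0); first by rewrite [RHS]mxE.
    by rewrite !trmx_mul trmxK symP !mulmxA.
  - by move=> t _; exact: V_ge0.
  - by move=> t _; have := HM (x t)^T; rewrite /V; lra.
apply/cvg_mxP => i j; rewrite (ord1 j) mxE; apply/cvgr0Pnorm_lt => d d0.
(* The threshold comes from [e' x_i^2 <= e' |x|^2 <= V]. *)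
have de0 : 0 < e' * d ^+ 2 by rewrite mulr_gt0 // exprn_gt0.
move/cvgr0Pnorm_lt : Vcvg => /(_ _ de0); apply: filterS => t.
rewrite ger0_norm // => Vt; rewrite -(ltr_pXn2r (n := 2)) ?nnegrE ?normr_ge0 ?(ltW d0) //.
rewrite -(ltr_pM2l e'0); apply: le_lt_trans (le_lt_trans (Ppos (x t)^T) Vt).
rewrite ler_pM2l // real_normK ?num_real // quad1 (bigD1 i) //= mxE lerDl.
by rewrite sumr_ge0 // => k _; rewrite sqr_ge0.
Qed.

Theorem attractive_hurwitz n (M : 'M[R]_n) :
  (forall x : R -> 'cV[R]_n,
    (forall t : R, 0 <= t -> is_derive t (1 : R) x (M *m x t)) ->
    x t @[t --> +oo] --> (0 : 'cV[R]_n)) ->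
  hurwitz M.
Proof.
move=> HM; rewrite -[M]trmxK; apply: hurwitz_tr => s.
case/real_eigenvectors => a [b [ab0 aM bM]]; rewrite ltNge; apply/negP => s0.
move: (complex.Re s) (complex.Im s) => p q in s0 aM bM *.
have {aM} Ma : M *m a^T = p *: a^T - q *: b^T.
  by rewrite -[M]trmxK -trmx_mul aM raddfB /= !linearZ.
have {bM} Mb : M *m b^T = q *: a^T + p *: b^T.
  by rewrite -[M]trmxK -trmx_mul bM raddfD /= !linearZ.
(* Real and imaginary parts of [exp (s t) (a + i b)], a complex solution. *)
pose f (t : R) := expR (p * t) * cos (q * t).
pose g (t : R) := expR (p * t) * sin (q * t).
have Hf (t : R) : is_derive t (1 : R) f (p * f t - q * g t).
  have H1 := is_derive1_comp (is_derive_expR (p * t)) (is_derive_mulrl p t).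
  have H2 := is_derive1_comp (is_derive_cos (q * t)) (is_derive_mulrl q t).
  by apply: (is_derive_eq (is_deriveM H1 H2)); rewrite /f /g /GRing.scale /=; ring.
have Hg (t : R) : is_derive t (1 : R) g (q * f t + p * g t).
  have H1 := is_derive1_comp (is_derive_expR (p * t)) (is_derive_mulrl p t).
  have H2 := is_derive1_comp (is_derive_sin (q * t)) (is_derive_mulrl q t).
  by apply: (is_derive_eq (is_deriveM H1 H2)); rewrite /f /g /GRing.scale /=; ring.
have Hscale (h k : R -> R) (t dh dk : R) (u v : 'cV[R]_n) :
    is_derive t (1 : R) h dh -> is_derive t (1 : R) k dk ->
    is_derive t (1 : R) (fun s => h s *: u + k s *: v) (dh *: u + dk *: v).
  move=> Hh Hk; apply/is_derive_mxP => i j.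
  have Hu := is_deriveM Hh (is_derive_cst (u i j) t 1).
  have Hv := is_deriveM Hk (is_derive_cst (v i j) t 1).
  rewrite (_ : (fun s => _) = h * cst (u i j) + k * cst (v i j)); last first.
    by apply/funext => z; rewrite !mxE.
  by apply: (is_derive_eq (is_deriveD Hu Hv)); rewrite !mxE /GRing.scale /=; ring.
have H1 : f t *: a^T + - g t *: b^T @[t --> +oo] --> (0 : 'cV[R]_n).
  apply: HM => t _; apply: (is_derive_eq (Hscale _ _ _ _ _ _ _ (Hf t) (is_deriveN (Hg t)))).
  rewrite mulmxDr -!scalemxAr Ma Mb.
  by apply/matrixP => i j; rewrite !mxE; ring.
have H2 : g t *: a^T + f t *: b^T @[t --> +oo] --> (0 : 'cV[R]_n).
  apply: HM => t _; apply: (is_derive_eq (Hscale _ _ _ _ _ _ _ (Hg t) (Hf t))).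
  rewrite mulmxDr -!scalemxAr Ma Mb.
  by apply/matrixP => i j; rewrite !mxE; ring.
(* The squared [j]-th coordinates of the two solutions sum to [expR (p * t) ^+ 2] times
   [a_j^2 + b_j^2]. For [p >= 0] this never drops below its initial value, yet it tends to 0. *)
have ab j : a 0 j ^+ 2 + b 0 j ^+ 2 <= 0.
  have /cvg_mxP/(_ j 0) H1j := H1; have /cvg_mxP/(_ j 0) H2j := H2.
  have := cvgD (cvgM H1j H1j) (cvgM H2j H2j); rewrite !mxE mulr0 addr0.
  move=> Hj; rewrite leNgt; apply/negP => ab_gt0.
  have [t [t0 ht]] : exists t : R, 0 <= t /\ (f t *: a^T + - g t *: b^T) j 0 *
      (f t *: a^T + - g t *: b^T) j 0 + (g t *: a^T + f t *: b^T) j 0 *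
      (g t *: a^T + f t *: b^T) j 0 < a 0 j ^+ 2 + b 0 j ^+ 2.
    have near_lt := cvgr_lt _ (Hj _ _ _) _ ab_gt0.
    apply: (@filter_ex _ (pinfty_nbhs R)); near=> t; split; first by [].
    by near: t; exact: near_lt.
  move: ht; apply/negP; rewrite -leNgt !mxE.
  have -> : (f t * a 0 j + - g t * b 0 j) * (f t * a 0 j + - g t * b 0 j) +
    (g t * a 0 j + f t * b 0 j) * (g t * a 0 j + f t * b 0 j) =
    expR (p * t) ^+ 2 * (cos (q * t) ^+ 2 + sin (q * t) ^+ 2) * (a 0 j ^+ 2 + b 0 j ^+ 2).
    by rewrite /f /g; ring.
  rewrite cos2Dsin2 mulr1 ler_peMl ?(ltW ab_gt0) // exprn_ege1 //.
  by rewrite -(expR0 R) ler_expR mulr_ge0.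
have a0 : a = 0.
  apply/rowP => j; rewrite mxE; apply/eqP; rewrite -sqrf_eq0 eq_le sqr_ge0 andbT.
  by apply: le_trans (ab j); rewrite lerDl sqr_ge0.
have b0 : b = 0.
  apply/rowP => j; rewrite mxE; apply/eqP; rewrite -sqrf_eq0 eq_le sqr_ge0 andbT.
  by apply: le_trans (ab j); rewrite lerDr sqr_ge0.
by move: ab0; rewrite a0 b0 eqxx.
Unshelve. all: end_near. Qed.

End Analysis.

(** * The closed loop *)

Section Regulator.
Local Open Scope classical_set_scope.
Local Open Scope complex_scope.
Variable R : realType.

(** * Integral extensions and system zeros at the origin *)

(** A left eigenvector [(v1, v2)] satisfies [s v2 = 0]. If [v2 = 0], then [v1] is tested by the pair
    [(A, B)]; if [s = 0], the test is triviality of the left kernel of [[[A, B], [D, G]]]. *)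
Lemma hautus_integral (C : numClosedFieldType) n m k (A : 'M[C]_n)
    (B : 'M[C]_(n, m)) (D : 'M[C]_(k, n)) (G : 'M[C]_(k, m)) :
  hautus (block_mx A 0 D 0) (col_mx B G) <->
  hautus A B /\ row_free (block_mx A B D G).
Proof.
have mulE (v1 : 'rV[C]_n) (v2 : 'rV[C]_k) : row_mx v1 v2 *m block_mx A 0 D 0 =
    row_mx (v1 *m A + v2 *m D) 0.
  by rewrite mul_row_block !mulmx0 addr0.
split=> [hA|[hAB rfr] s v s0]; last first.
  rewrite -[v]hsubmxK; move: (lsubmx v) (rsubmx v) => v1 v2.
  rewrite mulE scale_row_mx mul_row_col => /eq_row_mx[v1A /esym/eqP].
  rewrite scaler_eq0 => /orP[/eqP s00|/eqP v20] vB.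
    rewrite -[LHS](mulmxKp rfr) (_ : _ *m block_mx _ _ _ _ = 0) ?mul0mx //.
    by rewrite mul_row_block vB v1A s00 scale0r row_mx0.
  rewrite v20 !mul0mx !addr0 in v1A vB *.
  by rewrite (hAB _ _ s0 v1A vB) row_mx0.
split.
  move=> s v s0 vA vB; have /eq_row_mx[] // : row_mx v (0 : 'rV[C]_k) = row_mx 0 0.
  rewrite row_mx0; apply: (hA s) => //.
    by rewrite mulE mul0mx addr0 vA scale_row_mx scaler0.
  by rewrite mul_row_col mul0mx addr0 vB.
rewrite -kermx_eq0; apply/eqP/row_matrixP => i; rewrite row0.
have := row_mul i (kermx (block_mx A B D G)) (block_mx A B D G).
rewrite mulmx_ker row0; move: (row i _) => v.
rewrite -[v]hsubmxK; move: (lsubmx v) (rsubmx v) => v1 v2.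
rewrite mul_row_block -row_mx0 => /esym/eq_row_mx[v1A v1B].
apply: (hA 0); rewrite ?raddf0 // ?scale0r ?mulE ?v1A ?row_mx0 //.
by rewrite mul_row_col.
Qed.

(** At 0 the two sign changes amount to left multiplication by the invertible [diag(-1, 1)]. *)
Lemma system_zero0 n m k (A : 'M[R]_n) (B : 'M[R]_(n, m)) (C : 'M[R]_(k, n))
    (D : 'M[R]_(k, m)) :
  system_zero A B C D 0 <->
  (\rank (Cmx (block_mx A B C D)) < n + minn m k)%N.
Proof.
rewrite /system_zero (_ : block_mx _ _ _ _ =
  block_mx (- 1%:M) 0 0 1%:M *m Cmx (block_mx A B C D)).
  rewrite eqmxMfull // row_full_unit unitmxE det_ublock det1 mulr1 -scaleN1r.
  by rewrite detZ det1 mulr1 unitrX // unitrN unitr1.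
rewrite /Cmx map_block_mx mulmx_block !mulNmx !mul1mx !mul0mx !addr0 !add0r.
by rewrite (_ : (0 : R[i])%:M = 0) ?sub0r //; apply/matrixP => i j; rewrite !mxE mul0rn.
Qed.

(** When [k <= m] the rank bound equals the number of rows; conversely full row rank forces
    [n + k <= n + m]. *)
Lemma no_zero_system_zero n m k (A : 'M[R]_n) (B : 'M[R]_(n, m))
    (C : 'M[R]_(k, n)) (D : 'M[R]_(k, m)) :
  (k <= m)%N /\ (forall s0, system_zero A B C D s0 -> s0 <> 0) <->
  row_free (Cmx (block_mx A B C D)).
Proof.
split=> [[km zero0]|rfr].
  rewrite /row_free eqn_leq rank_leq_row /= leqNgt; apply/negP => rk.
  by apply: (zero0 0 _ erefl); apply/system_zero0; rewrite (minn_idPr km).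
have km : (k <= m)%N by rewrite -(leq_add2l n) -(eqP rfr) rank_leq_col.
by split=> // s0 + s00; rewrite s00 => /system_zero0; rewrite (eqP rfr) (minn_idPr km) ltnn.
Qed.

Lemma system_zero0_tr n m k (A : 'M[R]_n) (B : 'M[R]_(n, m)) (C : 'M[R]_(k, n))
    (D : 'M[R]_(k, m)) :
  system_zero A^T C^T B^T D^T 0 <-> system_zero A B C D 0.
Proof. by rewrite !system_zero0 -tr_block_mx /Cmx -map_trmx mxrank_tr minnC. Qed.

Lemma eigenvalue_ublock (F : fieldType) m n (M : 'M[F]_m) G (N : 'M[F]_n) s :
  eigenvalue (block_mx M G 0 N) s = eigenvalue M s || eigenvalue N s.
Proof.
rewrite !eigenvalue_unitmx (scalar_mx_block m n) opp_block_mx add_block_mx.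
by rewrite !oppr0 !addr0 !unitmxE det_ublock unitrM negb_and.
Qed.

Lemma hurwitz_ublock m n (M : 'M[R]_m) G (N : 'M[R]_n) :
  hurwitz (block_mx M G 0 N) <-> hurwitz M /\ hurwitz N.
Proof.
rewrite /hurwitz /Cmx map_block_mx map_mx0; split=> [h|[hM hN] s].
  by split=> s sM; apply: h; rewrite eigenvalue_ublock sM ?orbT.
by rewrite eigenvalue_ublock => /orP[/hM|/hN].
Qed.

Lemma hurwitz_unitmx n (M : 'M[R]_n) : hurwitz M -> M \in unitmx.
Proof.
move=> hM; rewrite -(map_unitmx (real_complex R)); apply: contraT => Mu.
suff /hM : eigenvalue (Cmx M) 0 by rewrite ltxx.
by rewrite eigenvalue_unitmx raddf0 subr0.
Qed.

Variables (n r d l p : nat).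
Variables (A : 'M[R]_n) (B : 'M[R]_(n, r)) (E : 'M[R]_(n, p)).
Variables (D : 'M[R]_(d, n)) (H : 'M[R]_(l, n)) (F : 'M[R]_(l, p)).

Definition regulator_mx K1 K2 : 'M[R]_(n + d) :=
  block_mx (A + B *m K1) (B *m K2) D 0.

Definition observer_mx L : 'M[R]_(n + p) :=
  block_mx A E 0 0 - L *m row_mx H F.

(** Since [u = K1 x + K2 q + K1 (xh - x)], the estimation error enters the plant through [B K1],
    while its own dynamics is autonomous. *)
Definition closed_loop_mx K1 K2 L : 'M[R]_(n + d + (n + p)) :=
  block_mx (regulator_mx K1 K2) (block_mx (B *m K1) 0 0 0) 0 (observer_mx L).

Lemma stabilizable_integral :
  (exists K1 K2, hurwitz (regulator_mx K1 K2)) <->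
  stabilizable (block_mx A 0 D 0) (col_mx B 0).
Proof.
have regE K1 K2 : regulator_mx K1 K2 =
    block_mx A 0 D 0 + col_mx B 0 *m row_mx K1 K2.
  by rewrite mul_col_row add_block_mx !mul0mx !addr0 add0r.
split=> [[K1 [K2 hK]]|[K]]; first by exists (row_mx K1 K2); rewrite -regE.
by rewrite -[K]hsubmxK -regE => hK; exists (lsubmx K), (rsubmx K).
Qed.

(** Duality: transposition turns the observer gain [L] into the feedback [- L^T]. *)
Lemma detectable_extended :
  (exists L, hurwitz (observer_mx L)) <->
  stabilizable (block_mx A^T 0 E^T 0) (col_mx H^T F^T).
Proof.
have obsE L : (observer_mx L)^T =
    block_mx A^T 0 E^T 0 + col_mx H^T F^T *m (- L^T).
  by rewrite /observer_mx raddfB /= tr_block_mx !trmx0 trmx_mul tr_row_mx mulmxN.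
split=> [[L hL]|[K hK]]; first by exists (- L^T); rewrite -obsE; apply: hurwitz_tr.
exists (- K^T); rewrite -[observer_mx _]trmxK; apply: hurwitz_tr.
by rewrite obsE [(- K^T)^T]linearN /= trmxK opprK.
Qed.

Lemma regulator_conditions :
  (exists K1 K2, hurwitz (regulator_mx K1 K2)) <->
  stabilizable A B /\
  ((d <= r)%N /\ (forall s0, system_zero A B D 0 s0 -> s0 <> 0)).
Proof.
rewrite stabilizable_integral !stabilizable_hautus no_zero_system_zero.
rewrite /Cmx !map_block_mx map_col_mx !map_mx0.
exact: hautus_integral.
Qed.

Lemma observer_conditions :
  (exists L, hurwitz (observer_mx L)) <->
  detectable A H /\
  ((p <= l)%N /\ (forall s0, system_zero A E H F s0 -> s0 <> 0)).
Proof.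
have zeroT : (forall s0, system_zero A E H F s0 -> s0 <> 0) <->
    (forall s0, system_zero A^T H^T E^T F^T s0 -> s0 <> 0).
  by split=> h s0 + s00; rewrite s00 => /(system_zero0_tr A E H F) /h; apply.
rewrite detectable_extended zeroT no_zero_system_zero /detectable !stabilizable_hautus.
rewrite /Cmx !map_block_mx map_col_mx !map_mx0.
exact: hautus_integral.
Qed.

Lemma is_derive_subr_cst m (x : R -> 'cV[R]_m) c t dx :
  is_derive t (1 : R) (fun s => x s - c) dx <-> is_derive t (1 : R) x dx.
Proof.
have addcst (y : R -> 'cV[R]_m) b : is_derive t (1 : R) y dx ->
    is_derive t (1 : R) (fun s => y s + b) dx.
  move=> Hy; have := is_deriveD Hy (is_derive_cst b t 1).
  by rewrite addr0.
split=> [Hx|]; last exact: addcst.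
by have := addcst _ c Hx; under eq_fun do rewrite subrK.
Qed.

(** Subtracting the equilibrium [(xs, qs)] removes the constant inputs. The pair [(x, w)] obeys the
    observer equation without its correction term, so [u] cancels from the error. *)
Lemma closed_loopP K1 K2 L w zr xs qs x q xh wh :
  A *m xs + B *m (K1 *m xs + K2 *m qs) + E *m w = 0 -> D *m xs = zr ->
  closed_loop A B E D H F K1 K2 L w zr x q xh wh <->
  let xi t := col_mx (col_mx (x t - xs) (q t - qs)) (col_mx (xh t - x t) (wh t - w)) in
  forall t : R, 0 <= t -> is_derive t (1 : R) xi (closed_loop_mx K1 K2 L *m xi t).
Proof.
move=> eqx eqz.
have fieldE t : let u := K1 *m xh t + K2 *m q t in
    closed_loop_mx K1 K2 L *m
      col_mx (col_mx (x t - xs) (q t - qs)) (col_mx (xh t - x t) (wh t - w)) =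
    col_mx (col_mx (A *m x t + B *m u + E *m w) (D *m x t - zr))
      (block_mx A E 0 0 *m col_mx (xh t) (wh t) + col_mx B 0 *m u
       + L *m (H *m x t + F *m w - row_mx H F *m col_mx (xh t) (wh t))
       - col_mx (A *m x t + B *m u + E *m w) 0).
  move=> u; rewrite mul_block_col mul0mx add0r; congr col_mx.
    rewrite !mul_block_col !mul0mx !addr0 add_col_mx addr0 !mulmxBr eqz; congr col_mx.
    have -> : E *m w = - (A *m xs + B *m (K1 *m xs + K2 *m qs)).
      by apply/eqP; rewrite -addr_eq0 addrC eqx.
    rewrite /u !mulmxDr !mulmxDl !mulmxA.
    move: (A *m x t) (A *m xs) (B *m K1 *m x t) => a1 a2 a3.
    move: (B *m K1 *m xs) (B *m K2 *m q t) (B *m K2 *m qs) (B *m K1 *m xh t) => a4 a5 a6 a7.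
    by apply/matrixP => i j; rewrite !mxE; ring.
  have -> : H *m x t + F *m w = row_mx H F *m col_mx (x t) w by rewrite mul_row_col.
  have -> : col_mx (A *m x t + B *m u + E *m w) (0 : 'cV_p) =
      block_mx A E 0 0 *m col_mx (x t) w + col_mx B 0 *m u.
    rewrite mul_block_col mul_col_mx !mul0mx add_col_mx !addr0.
    by rewrite addrAC.
  have -> : col_mx (xh t - x t) (wh t - w) =
      col_mx (xh t) (wh t) - col_mx (x t) w by rewrite opp_col_mx add_col_mx.
  rewrite /observer_mx; move: (col_mx _ _) (col_mx (x t) w) (col_mx B 0 *m u) => X Y Z.
  rewrite mulmxBl !mulmxBr !mulmxA.
  move: (block_mx A E 0 0 *m X) (block_mx A E 0 0 *m Y) => a1 a2.
  move: (L *m row_mx H F *m X) (L *m row_mx H F *m Y) => a3 a4.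
  by apply/matrixP => i j; rewrite !mxE; ring.
have errE s : col_mx (xh s - x s) (wh s - w) =
    col_mx (xh s) (wh s) - col_mx (x s) w by rewrite opp_col_mx add_col_mx.
have Hxw t dx : is_derive t (1 : R) x dx ->
    is_derive t (1 : R) (fun s => col_mx (x s) w) (col_mx dx 0).
  by move=> Hx; apply/is_derive_col_mx; split=> //; exact: is_derive_cst.
split=> [Hcl xi t t0|Hcl t t0].
  have [Hx Hq Hh] := Hcl t t0; rewrite /xi fieldE.
  apply/is_derive_col_mx; split.
    by apply/is_derive_col_mx; split; apply/is_derive_subr_cst.
  by under eq_fun do rewrite errE; exact: is_deriveB Hh (Hxw _ _ Hx).
have /= := Hcl t t0; rewrite fieldE => /is_derive_col_mx[].
case/is_derive_col_mx => /is_derive_subr_cst Hx /is_derive_subr_cst Hq Hh.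
split => //; move: Hh; under eq_fun do rewrite errE.
by move=> Hh; have := is_deriveD Hh (Hxw _ _ Hx); rewrite !subrK.
Qed.

Lemma PI_regulatorP K1 K2 L :
  PI_regulator A B E D H F K1 K2 L <->
  hurwitz (regulator_mx K1 K2) /\ hurwitz (observer_mx L).
Proof.
rewrite -(hurwitz_ublock _ (block_mx (B *m K1) 0 0 0)); split=> [[stable _ _]|hcl].
  apply: attractive_hurwitz => xi Hxi.
  (* Any solution of the autonomous system is realised by a closed-loop trajectory with [w = 0],
     [zr = 0] and equilibrium at the origin. *)
  pose x t := usubmx (usubmx (xi t)); pose q t := dsubmx (usubmx (xi t)).
  pose e t := usubmx (dsubmx (xi t)); pose wh t := dsubmx (dsubmx (xi t)).
  pose xh t := e t + x t.
  have eq0 : A *m (0 : 'cV_n) + B *m (K1 *m (0 : 'cV_n) + K2 *m (0 : 'cV_d)) +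
      E *m (0 : 'cV_p) = 0 by rewrite !(mulmx0, addr0).
  have /(closed_loopP L x q xh wh eq0)[_] := mulmx0 1 D.
  have -> : (fun t => col_mx (col_mx (x t - 0) (q t - 0))
       (col_mx (xh t - x t) (wh t - 0))) = xi.
    by apply/funext => t; rewrite !subr0 /xh addrK /x /q /e /wh !vsubmxK.
  move=> /(_ Hxi) /stable[x0 q0 xh0 wh0].
  have xiE : xi = fun t => col_mx (col_mx (x t) (q t)) (col_mx (xh t - x t) (wh t)).
    by apply/funext => t; rewrite /xh addrK /x /q /e /wh !vsubmxK.
  rewrite xiE -[0]vsubmxK -[usubmx 0]vsubmxK -[dsubmx 0]vsubmxK !linear0.
  apply/cvg_col_mx; split; apply/cvg_col_mx; split => //.
  by rewrite -[0](subrr 0); apply: cvgB.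
have [hreg hobs] := (hurwitz_ublock _ _ _).1 hcl.
have main w zr x q xh wh : closed_loop A B E D H F K1 K2 L w zr x q xh wh ->
    exists (xs : 'cV[R]_n) (qs : 'cV[R]_d),
    [/\ w = 0 -> zr = 0 -> xs = 0 /\ qs = 0, D *m xs = zr &
    [/\ x t @[t --> +oo] --> xs, q t @[t --> +oo] --> qs,
      xh t - x t @[t --> +oo] --> (0 : 'cV[R]_n) &
      wh t @[t --> +oo] --> w]].
  (* The equilibrium exists because a Hurwitz matrix is invertible; its second block row reads
     [D xs = zr], which yields tracking. *)
  pose eqm := invmx (regulator_mx K1 K2) *m col_mx (- (E *m w)) zr.
  have : regulator_mx K1 K2 *m eqm = col_mx (- (E *m w)) zr.
    by rewrite mulKVmx ?hurwitz_unitmx.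
  rewrite -[eqm]vsubmxK mul_block_col mul0mx addr0 => /eq_col_mx[eqx eqz].
  have eqx' : A *m usubmx eqm + B *m (K1 *m usubmx eqm + K2 *m dsubmx eqm) + E *m w = 0.
    by rewrite mulmxDr addrA !mulmxA -mulmxDl eqx addNr.
  move=> /(closed_loopP _ _ _ _ _ eqx' eqz) /(hurwitz_cvg0 hcl).
  rewrite -[0]vsubmxK -[usubmx 0]vsubmxK -[dsubmx 0]vsubmxK !linear0.
  case/cvg_col_mx => /cvg_col_mx[x0 q0] /cvg_col_mx[e0 w0].
  have shift m (f : R -> 'cV[R]_m) (c : 'cV[R]_m) :
      f t - c @[t --> +oo] --> (0 : 'cV[R]_m) -> f t @[t --> +oo] --> c.
    by move=> /subr_cvg0.
  exists (usubmx eqm), (dsubmx eqm); split; [|exact: eqz|split => //; exact: shift].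
  by move=> w00 zr0; rewrite /eqm w00 zr0 mulmx0 oppr0 col_mx0 mulmx0 !linear0.
split=> [x q xh wh /main|w zr x q xh wh /main|w zr x q xh wh /main].
- move=> [xs [qs [/(_ erefl erefl)[-> ->] _ [x0 q0 e0 wh0]]]]; split => //.
  have xhE : xh = (fun t => xh t - x t + x t) by apply/funext => t; rewrite subrK.
  by rewrite xhE -[0]addr0; exact: cvgD e0 x0.
- by move=> [xs [qs [_ _ []]]].
- by move=> [xs [qs [_ <- [x0 _ _ _]]]]; apply: cvg_mulmxl.
Qed.

End Regulator.

Theorem theorem10p1 (R : realType) (n r d l p : nat)
    (A : 'M[R]_n) (B : 'M[R]_(n, r)) (E : 'M[R]_(n, p))
    (D : 'M[R]_(d, n)) (H : 'M[R]_(l, n)) (F : 'M[R]_(l, p))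
    (rankB : \rank B = r) (rankD : \rank D = d) :
  (exists (K1 : 'M[R]_(r, n)) (K2 : 'M[R]_(r, d)) (L : 'M[R]_(n + p, l)),
      PI_regulator A B E D H F K1 K2 L)
  <->
  [/\ stabilizable A B,
      detectable A H,
      (d <= r)%N /\ (p <= l)%N &
      (forall s0 : R[i], system_zero A E H F s0 -> s0 <> 0) /\
      (forall s0 : R[i], system_zero A B D 0 s0 -> s0 <> 0)].
Proof.
(* The choices decouple: [K1], [K2] concern only [(A, B, D)], and [L] only [(A, E, H, F)]. *)
split=> [[K1 [K2 [L /PI_regulatorP[hreg hobs]]]]|[sAB dAH [dr pl] [zEF zBD]]].
  have [|sAB [dr zBD]] := (regulator_conditions A B D).1; first by exists K1, K2.
  have [|dAH [pl zEF]] := (observer_conditions A E H F).1; first by exists L.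
  by split.
have [//|K1 [K2 hreg]] := (regulator_conditions A B D).2.
have [//|L hobs] := (observer_conditions A E H F).2.
by exists K1, K2, L; apply/PI_regulatorP.
Qed.
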